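(* Let $I\subset\mathbb{R}$ be a nondegenerate interval, let $n\in\mathbb{N}$, let $\omega=(\omega_1,\dots,\omega_n):I\to\mathbb{R}^n$ be an $n$-dimensional positive Chebyshev system over $I$, and let $\omega_{n+1}:I\to\mathbb{R}$ be such that $\omega^*=(\omega_1,\dots,\omega_n,\omega_{n+1})$ is an $(n+1)$-dimensional positive Chebyshev system over $I$. A function $f:I\to\mathbb{R}$ is $\omega$-Jensen convex on $I$ if and only if, for all $p\in I$, there exists an interval $U\subseteq I$ that is a neighborhood of $p$ in $I$ such that $f$ is $\omega$-Jensen convex on $U$.
   Context: $\mathbb{N}$ is the set of positive integers. $\sigma_k(I):=\{(x_1,\dots,x_k)\in I^k\mid x_1<\dots<x_k\}$. For $\omega=(\omega_1,\dots,\omega_k):I\to\mathbb{R}^k$ and $(x_1,\dots,x_k)\in\sigma_k(I)$, $\Phi_\omega(x_1,\dots,x_k):=\det\big(\omega_i(x_j)\big)_{i,j=1}^k$. $\omega$ is a $k$-dimensional positive Chebyshev system over $I$ if $\Phi_\omega>0$ on $\sigma_k(I)$. For an $n$-dimensional $\omega$ and $f:I\to\mathbb{R}$, $(\omega,f):=(\omega_1,\dots,\omega_n,f)$. For a nondegenerate interval $J\subseteq I$, $f$ is $\omega$-Jensen convex on $J$ if $\Phi_{(\omega,f)}(x,x+h,\dots,x+nh)\ge0$ for all $h>0$ and $x\in J$ with $x+nh\in J$. (The auxiliary function $\omega_{n+1}$ is part of the paper's standing setting; it does not enter the equivalence.) *)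

(* Defs.v *)
From mathcomp Require Import all_boot all_order all_algebra.
From mathcomp Require Import all_classical all_reals all_analysis.

Set Implicit Arguments.
Unset Strict Implicit.
Unset Printing Implicit Defensive.

Import Order.TTheory GRing.Theory Num.Theory.
Import numFieldNormedType.Exports.

Local Open Scope classical_set_scope.
Local Open Scope ring_scope.

(* A function on an interval I is represented by a
   total function on R of which only the values on I are ever used; points of
   R^k are row vectors. *)

Definition nondegenerate_interval (R : realType) (I : set R) : Prop :=
  is_interval I /\ exists x y : R, [/\ I x, I y & x < y].

Definition sigma (R : realType) (k : nat) (I : set R) : set 'rV[R]_k :=
  [set x | (forall j : 'I_k, I (x 0 j)) /\
           (forall i j : 'I_k, (i < j)%N -> x 0 i < x 0 j)].

Definition Phi (R : realType) (k : nat) (omega : R -> 'rV[R]_k)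
    (x : 'rV[R]_k) : R :=
  \det (\matrix_(i < k, j < k) omega (x 0 j) 0 i).

Definition positive_Chebyshev_system (R : realType) (k : nat) (I : set R)
    (omega : R -> 'rV[R]_k) : Prop :=
  forall x : 'rV[R]_k, sigma I x -> 0 < Phi omega x.

(* (omega_1, ..., omega_n, f) *)
Definition adjoin (R : realType) (n : nat) (omega : R -> 'rV[R]_n)
    (f : R -> R) : R -> 'rV[R]_(n + 1) :=
  fun t => row_mx (omega t) (f t)%:M.

(* Meant for a nondegenerate interval J, so that x, x + h, ..., x + n h all
   lie in J once the two extreme points do. *)
Definition Jensen_convex (R : realType) (n : nat) (omega : R -> 'rV[R]_n)
    (J : set R) (f : R -> R) : Prop :=
  forall x h : R, 0 < h -> J x -> J (x + n%:R * h) ->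
    0 <= Phi (adjoin omega f) (\row_(j < n + 1) (x + j%:R * h)).

(* Main.v *)
(* By compactness of [x, x + n h], all progressions of sufficiently small step
   h / m inside it satisfy the local convexity inequality, so
   Phi_{(omega, f)} >= 0 on consecutive points of the grid of step h / m.
   This extends to arbitrary increasing (n+1)-tuples of the grid by induction on
   their length: insert a missing grid point between two points of the tuple; of
   the resulting n+2 points, omitting the first or the last gives a shorter
   tuple, and Phi of the original tuple is a combination of these two values
   with positive coefficients. *)
Require Import Defs.
From mathcomp Require Import all_boot all_order all_algebra.
From mathcomp Require Import all_classical all_reals all_analysis.
From mathcomp Require Import zify lra.

Import Order.TTheory GRing.Theory Num.Theory.
Import numFieldNormedType.Exports.

Local Open Scope classical_set_scope.
Local Open Scope ring_scope.

Lemma ltn_step_homo (n : nat) (s : nat -> nat) :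
  (forall i, (i < n)%N -> (s i < s i.+1)%N) ->
  forall i j, (i < j)%N -> (j <= n)%N -> (s i < s j)%N.
Proof.
move=> s_incr i; elim=> // j IHj; rewrite ltnS leq_eqVlt => /orP[/eqP -> | ij] jn.
  exact: s_incr.
exact: ltn_trans (IHj ij (ltnW jn)) (s_incr _ jn).
Qed.

(** * Determinants with the row of [f] adjoined *)

Section DeterminantExpansion.
Context {R : realType} {n : nat} (omega : R -> 'rV[R]_n).

Lemma Phi_adjoinE (f : R -> R) (x : 'rV[R]_(n + 1)) :
  Phi (adjoin omega f) x =
  \det (col_mx (\matrix_(i < n, j < n + 1) omega (x 0 j) 0 i)
               (\row_j f (x 0 j))).
Proof.
congr (\det _); apply/matrixP => i j; rewrite !mxE.
by case: (fintype.split i) => k; rewrite !mxE // !ord1 eqxx mulr1n.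
Qed.

(** Laplace expansion along the last row, that of [f]. Tuples are coded as functions on [nat], so
    that deleting the entry of index [j] is precomposition with [bump j] and each minor is again a
    value of [Phi omega]. *)
Lemma Phi_adjoin_expand (f : R -> R) (u : nat -> R) :
  Phi (adjoin omega f) (\row_(j < n + 1) u j) =
  \sum_(j < n + 1)
    (-1) ^+ (n + j) * f (u j) * Phi omega (\row_(k < n) u (bump j k)).
Proof.
(* The minors have size [(n + 1).-1], which equals [n] only up to a cast. *)
have det_cast m (e : m = n) (B : 'M[R]_m) (C : 'M[R]_n) :
    (forall i j, B i j = C (cast_ord e i) (cast_ord e j)) -> \det B = \det C.
  case: n / e C => C BC; congr (\det _); apply/matrixP => i j.
  by rewrite BC !cast_ord_id.
rewrite Phi_adjoinE (expand_det_row _ (rshift n ord0)); apply: eq_bigr => j _.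
rewrite col_mxEd !mxE mulrCA mulrA /cofactor /= addn0.
congr (_ * _); apply: (det_cast _ (congr1 predn (addn1 n))) => i k.
have lift_lshift :
    lift (rshift n ord0) i = lshift 1 (cast_ord (congr1 predn (addn1 n)) i).
  apply: val_inj; rewrite /= /bump addn0.
  by have := ltn_ord (cast_ord (congr1 predn (addn1 n)) i) => /=; case: leqP; lia.
by rewrite [LHS]mxE [LHS]mxE lift_lshift col_mxEu !mxE.
Qed.

(** A row operation: it is left multiplication by a block triangular matrix of determinant 1. *)
Lemma Phi_adjoin_sub_span (f : R -> R) (c : 'rV[R]_n) (x : 'rV[R]_(n + 1)) :
  Phi (adjoin omega (fun t => f t - (c *m (omega t)^T) 0 0)) x =
  Phi (adjoin omega f) x.
Proof.
rewrite !Phi_adjoinE.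
set W := \matrix_(i, j) omega (x 0 j) 0 i; set F := \row_j f (x 0 j).
have -> : col_mx W (\row_j (f (x 0 j) - (c *m (omega (x 0 j))^T) 0 0)) =
    block_mx 1%:M 0 (- c) 1%:M *m col_mx W F.
  rewrite mul_block_col !mul1mx mul0mx addr0; congr col_mx.
  apply/rowP => j; rewrite !mxE addrC -sumrN; congr (_ + _).
  by apply: eq_bigr => i _; rewrite !mxE mulNr.
by rewrite det_mulmx det_lblock !det1 !mul1r.
Qed.

End DeterminantExpansion.

(** * Inserting a point into a tuple, and induction on a grid *)

Section Insertion.
Context {R : realType} {I : set R} {n : nat} {omega : R -> 'rV[R]_n}
  (omega_pos : positive_Chebyshev_system I omega).

Lemma Phi_gt0 (u : nat -> R) :
  (forall i, (i < n)%N -> I (u i)) ->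
  (forall i j, (i < j)%N -> (j < n)%N -> u i < u j) ->
  0 < Phi omega (\row_(k < n) u k).
Proof.
move=> Iu u_incr; apply: omega_pos; split=> [j | i j ij]; rewrite !mxE.
  exact: Iu.
exact: u_incr.
Qed.

(** The collocation matrix is invertible, so the linear system for the coefficients [c] of the
    interpolant is solvable. *)
Lemma Phi_interpolation (f : R -> R) (u : nat -> R) :
  Phi omega (\row_(k < n) u k) != 0 ->
  exists c : 'rV[R]_n,
    forall k, (k < n)%N -> f (u k) - (c *m (omega (u k))^T) 0 0 = 0.
Proof.
rewrite /Phi; set B := (X in \det X) => B_neq0.
have B_unit : B \in unitmx by rewrite unitmxE unitfE.
exists ((\row_j f (u j)) *m invmx B) => k kn; apply/eqP; rewrite subr_eq0.
have -> : (omega (u k))^T = col (Ordinal kn) B by apply/colP => i; rewrite !mxE.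
by rewrite -mulmxA colE [invmx B *m _]mulmxA mulVmx // mul1mx -colE !mxE.
Qed.

Lemma Phi_adjoin_insert (f : R -> R) (u : nat -> R) (j : nat) :
  (forall i, (i <= n.+1)%N -> I (u i)) ->
  (forall i k, (i < k)%N -> (k <= n.+1)%N -> u i < u k) ->
  (0 < j <= n)%N ->
  0 <= Phi (adjoin omega f) (\row_(i < n + 1) u (bump 0 i)) ->
  0 <= Phi (adjoin omega f) (\row_(i < n + 1) u (bump n.+1 i)) ->
  0 <= Phi (adjoin omega f) (\row_(i < n + 1) u (bump j i)).
Proof.
move=> Iu u_incr /andP[j_gt0 jn].
have W_gt0 a b : 0 < Phi omega (\row_(k < n) u (bump a (bump b k))).
  apply: (Phi_gt0 (fun k => u (bump a (bump b k)))) => [i i_n | i k ik kn].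
    by apply: Iu; rewrite /bump; lia.
  by apply: u_incr; rewrite /bump; lia.
(* Subtracting from f the combination of the omega_i that interpolates it at the
   n interior points leaves only the terms of the two extreme points. *)
have u1_gt0 : 0 < Phi omega (\row_(k < n) u k.+1).
  by apply: (Phi_gt0 (u \o succn)) => [i i_n | i k ik kn] /=;
    [exact/Iu/leqW | exact/u_incr/leqW].
have [c fu0] := Phi_interpolation f (u \o succn) (lt0r_neq0 u1_gt0).
rewrite -!(Phi_adjoin_sub_span _ f c); set g := fun t => _.
have gu0 k : (0 < k <= n)%N -> g (u k) = 0.
  by case: k => // k; apply: fu0.
rewrite !(Phi_adjoin_expand _ _ (fun i => u (bump _ i))).
have ord_le (i : 'I_(n + 1)) : (i <= n)%N by case: i => i; rewrite addn1.
(* Deleting [u 0] leaves only the term of the last column, with sign [(-1) ^+ (n + n) = 1]; hence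
   [0 <= g (u n.+1)]. *)
rewrite (bigD1 (rshift n ord0)) //= big1 => [|i i_neq]; last first.
  rewrite gu0 ?mulr0 ?mul0r // /bump /=.
  have := ord_le i; rewrite add1n /= leq_eqVlt => /orP[/eqP i_n|//].
  by case/eqP: i_neq; apply: val_inj; rewrite /= addn0.
rewrite addr0 pmulr_lge0 // addn0 addnn -mul2n exprM sqrrN expr1n expr1n mul1r.
have -> : bump 0 n = n.+1 by [].
move=> gun_ge0.
have lt0n1 : (0 < n + 1)%N by rewrite addn1.
(* Deleting [u n.+1] leaves only the term of column 0; hence [0 <= (-1) ^+ n * g (u 0)]. *)
rewrite (bigD1 (Ordinal lt0n1)) //= big1 => [|i i_neq]; last first.
  have i_le := ord_le i.
  have bump_i : bump n.+1 i = i by rewrite /bump ltnNge i_le.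
  rewrite bump_i gu0 ?mulr0 ?mul0r // i_le andbT lt0n.
  by apply: contra i_neq => /eqP i0; apply/eqP/val_inj.
rewrite addr0 pmulr_lge0 // addn0 => gu0_ge0.
(* Since [0 < j <= n], both extreme points remain, in columns 0 and [n] with the same signs as
   before; the other terms vanish. *)
apply: sumr_ge0 => i _; rewrite pmulr_lge0 //.
have [i0 | i_gt0] := posnP i.
  by rewrite i0 addn0; have -> : bump j 0 = 0%N by rewrite /bump; lia.
have i_le := ord_le i.
move: i_le; rewrite leq_eqVlt => /orP[/eqP i_n | i_n].
  have -> : bump j i = n.+1 by rewrite /bump; lia.
  by rewrite i_n addnn -mul2n exprM sqrrN expr1n expr1n mul1r.
by rewrite gu0 ?mulr0 // /bump; lia.
Qed.

Lemma Phi_adjoin_grid_ge0 (f : R -> R) (z : nat -> R) (N : nat) :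
  (forall i, (i <= N)%N -> I (z i)) ->
  (forall i j, (i < j)%N -> z i < z j) ->
  (forall a, (a + n <= N)%N ->
     0 <= Phi (adjoin omega f) (\row_(j < n + 1) z (a + j)%N)) ->
  forall s : nat -> nat,
    (forall i, (i < n)%N -> (s i < s i.+1)%N) -> (s n <= N)%N ->
    0 <= Phi (adjoin omega f) (\row_(j < n + 1) z (s j)).
Proof.
move=> Iz z_incr z_cons s.
(* The length for the induction is the index span [s n - s 0]; a tuple without gaps is
   consecutive. *)
have [d] := ubnP (s n - s 0)%N; elim: d s => // d IHd s s_d s_incr snN.
have [/existsP[k sk_gap] | s_tight] :=
  boolP [exists k : 'I_n, ((s k).+1 < s k.+1)%N]; last first.
  have sE i : (i <= n)%N -> s i = (s 0 + i)%N.
    elim: i => [|i IHi] i_n; first by rewrite addn0.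
    have := s_incr i i_n; move: s_tight; rewrite negb_exists.
    by move=> /forallP /(_ (Ordinal i_n)) /=; rewrite IHi ?(ltnW i_n) //; lia.
  have -> : \row_(j < n + 1) z (s j) = \row_(j < n + 1) z (s 0 + j)%N.
    apply/rowP => j; rewrite !mxE sE //.
    by case: j => j; rewrite addn1.
  by apply: z_cons; rewrite -sE.
have kn := ltn_ord k.
(* [v] is [s] with the index [(s k).+1] inserted at position [k.+1], so [s] is recovered as [v]
   composed with [bump k.+1]. *)
pose v i := if (i <= k)%N then s i else if i == k.+1 then (s k).+1 else s i.-1.
have v_step i : (i < n.+1)%N -> (v i < v i.+1)%N.
  rewrite /v => i_n; have := s_incr i; have := s_incr i.-1; move: sk_gap.
  have [ik|ik] := leqP i k.
    have [->|i_neq] := eqVneq i k; first by rewrite ltnn eqxx.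
    have -> : (i < k)%N by lia.
    by lia.
  have -> : (i < k)%N = false by lia.
  have -> : (i.+1 == k.+1) = false by lia.
  have [->|i_neq] := eqVneq i k.+1; first by move=> /=; lia.
  by case: i ik i_neq i_n => [|i] /=; lia.
have v_incr := ltn_step_homo n.+1 v v_step.
have v0 : v 0%N = s 0%N by [].
have vn1 : v n.+1 = s n by rewrite /v !ifF //; lia.
have v_le i : (i <= n.+1)%N -> (v i <= N)%N.
  rewrite leq_eqVlt => /orP[/eqP -> | i_n]; first by rewrite vn1.
  by apply: leq_trans snN; rewrite -vn1 ltnW // v_incr.
have -> : \row_(j < n + 1) z (s j) = \row_(j < n + 1) z (v (bump k.+1 j)).
  apply/rowP => j; rewrite !mxE /v /bump; congr (z _).
  have [jk|jk] := leqP k.+1 j; first by rewrite !ifF //; lia.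
  by rewrite ifT //; lia.
have v01 : (v 0 < v 1)%N by exact: v_step.
have vnn : (v n < v n.+1)%N by exact: v_step.
have v0n : (v 0 < v n)%N by apply: v_incr; lia.
have v1n : (v 1 < v n.+1)%N by apply: v_incr; lia.
apply: (Phi_adjoin_insert _ (z \o v)) => [i i_n | i j ij jn | | | ] /=.
- exact/Iz/v_le.
- exact/z_incr/v_incr.
- lia.
- apply: (IHd (v \o bump 0)) => [|i i_n|] /=.
  + by rewrite /bump /= !add1n; lia.
  + exact: v_step.
  + exact: v_le.
- have bumpn i : (i <= n)%N -> bump n.+1 i = i by rewrite /bump ltnNge => ->.
  apply: (IHd (v \o bump n.+1)) => [|i i_n|] /=.
  + by rewrite !bumpn //; lia.
  + by rewrite !bumpn ?(ltnW i_n) // v_step // ltnW.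
  + by rewrite bumpn // v_le.
Qed.

End Insertion.

(** * From local convexity to a uniform step, and to the whole interval *)

(** Compactness, in its near-covering form, makes the bound [d] on the total length [n%:R * h]
    uniform in the starting point [y]. *)
Lemma Jensen_convex_small_steps (R : realType) (I : set R) (n : nat)
    (omega : R -> 'rV[R]_n) (f : R -> R) (a b : R) :
  `[a, b] `<=` I ->
  (forall p : R, I p ->
     exists U : set R, within I (nbhs p) U /\ Jensen_convex omega U f) ->
  \forall d \near 0^'+, forall y h : R,
    0 < h -> n%:R * h < d -> a <= y -> y + n%:R * h <= b ->
    0 <= Phi (adjoin omega f) (\row_(j < n + 1) (y + j%:R * h)).
Proof.
move=> abI loc.
have := @segment_compact R a b => /compact_near_coveringP.
move=> /(_ R 0^'+ (fun d y => forall h : R,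
    0 < h -> n%:R * h < d -> a <= y -> y + n%:R * h <= b ->
    0 <= Phi (adjoin omega f) (\row_(j < n + 1) (y + j%:R * h)))) cover.
have /cover : forall p, `[a, b]%classic p -> \forall y \near p & d \near 0^'+,
    forall h : R, 0 < h -> n%:R * h < d -> a <= y -> y + n%:R * h <= b ->
    0 <= Phi (adjoin omega f) (\row_(j < n + 1) (y + j%:R * h)).
  move=> p pab; have [U [/nbhs_ballP[e /= e_gt0 peU] U_convex]] := loc p (abI _ pab).
  (* A start within [e / 2] of [p] and a total length below [e / 2] keep both end points within [e]
     of [p], hence in [U]. *)
  exists (ball p (e / 2), [set d | d < e / 2]).
    split=> /=; first by apply: nbhsx_ballx; rewrite divr_gt0.
    by apply: nbhs_right_lt; rewrite divr_gt0.
  case=> y d [/= py de] h h_gt0 hd ay yb.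
  have nh_ge0 : 0 <= n%:R * h by rewrite mulr_ge0 // ltW.
  move: py; rewrite -ball_normE /ball_ /= => py.
  apply: U_convex => //; apply: peU => /=.
  - by rewrite -ball_normE /ball_ /=; lra.
  - by apply: abI; rewrite /= in_itv /=; lra.
  - by rewrite -ball_normE /ball_ /= opprD addrA; move: py; rewrite !ltr_norml; lra.
  - by apply: abI; rewrite /= in_itv /=; lra.
apply: filter_app => //; near=> d => Hd y h h_gt0 hd ay yb.
apply: Hd => //=; rewrite in_itv /= ay /=; apply: le_trans yb.
by rewrite lerDl mulr_ge0 // ltW.
Unshelve. all: by end_near. Qed.

Theorem corollary15 (R : realType) (I : set R)
    (I_itv : nondegenerate_interval I)
    (n : nat) (n_gt0 : (0 < n)%N)
    (omega : R -> 'rV[R]_n)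
    (omega_pos : positive_Chebyshev_system I omega)
    (omega_n1 : R -> R)
    (omega_star_pos : positive_Chebyshev_system I (adjoin omega omega_n1))
    (f : R -> R) :
  Jensen_convex omega I f <->
  (forall p : R, I p ->
     exists U : set R,
       [/\ nondegenerate_interval U, U `<=` I,
           within I (nbhs p) U & Jensen_convex omega U f]).
Proof.
split=> [f_convex p Ip | loc x h h_gt0 Ix Ixh].
  by exists I; split=> //; apply: withinT.
have {}loc p : I p ->
    exists U : set R, within I (nbhs p) U /\ Jensen_convex omega U f.
  by move=> /loc[U [_ _ pU U_convex]]; exists U.
have xbI : `[x, x + n%:R * h] `<=` I.
  by move=> t /=; rewrite in_itv /=; apply: I_itv.1.
have small := Jensen_convex_small_steps _ _ _ _ _ _ _ xbI loc.
have [d [d_gt0 d_small]] := filter_ex (filterI (nbhs_right_gt 0) small).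
(* Chosen so that [m > n%:R * h / d]: progressions of step [h / m] then have total length below
   [d]. *)
pose m := (Num.truncn (n%:R * h / d)).+1.
have m_gt0 : 0 < m%:R :> R by rewrite ltr0n.
have hm_gt0 : 0 < h / m%:R by rewrite divr_gt0.
have nhm_lt : n%:R * (h / m%:R) < d.
  by rewrite mulrA ltr_pdivrMr // [d * _]mulrC -ltr_pdivrMr // truncnS_gt.
have grid_le i : (i <= n * m)%N -> x + i%:R * (h / m%:R) <= x + n%:R * h.
  move=> i_nm; rewrite lerD2l mulrA ler_pdivrMr // -mulrAC ler_pM2r //.
  by rewrite -natrM ler_nat.
have grid_ge i : x <= x + i%:R * (h / m%:R) by rewrite lerDl mulr_ge0 // ltW.
(* The given progression consists of every [m]-th point of the grid of step [h / m]. *)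
have -> : \row_(j < n + 1) (x + j%:R * h) =
    \row_(j < n + 1) (x + (j * m)%:R * (h / m%:R)).
  apply/rowP => j; rewrite !mxE natrM -mulrA; congr (_ + _ * _).
  by rewrite mulrC divfK // gt_eqF.
apply: (Phi_adjoin_grid_ge0 omega_pos f (fun i => x + i%:R * (h / m%:R))
          (n * m) _ _ _ (muln^~ m)) => [i i_nm | i j ij | a a_nm | i _ |] //.
- by apply: xbI; rewrite /= in_itv /= grid_ge grid_le.
- by rewrite ltrD2l ltr_pM2r // ltr_nat.
- have -> : \row_(j < n + 1) (x + (a + j)%:R * (h / m%:R)) =
      \row_(j < n + 1) (x + a%:R * (h / m%:R) + j%:R * (h / m%:R)).
    by apply/rowP => j; rewrite !mxE natrD mulrDl addrA.
  apply: d_small => //; rewrite -addrA -mulrDl -natrD.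
  exact: grid_le.
- by rewrite ltn_mul2r ltnSn.
Qed.
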